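(* Let $A\in\mathbb{R}^{M\times N}$ have nonzero columns and $\operatorname{rank}(A)=M<N$, and let $K\in\{1,\dots,M-1\}$. Assume that $A$ satisfies H1 for $K$. Let $d\in\mathbb{R}^M$, let $\beta_K\ge0$ be such that for every $\beta'>\beta_K$ each global minimizer $\hat u$ of $u\mapsto\|Au-d\|_2^2+\beta'\|u\|_0$ satisfies $\|\hat u\|_0\le K$ and $\sigma(\hat u)\in\overline{\Omega}_K$, and let $\beta>\beta_K$, $\beta>0$. Define $$\Sigma_K=\bigcup_{n=-K}^{K}\ \bigcup_{\omega\in\overline{\Omega}_K}\ \bigcup_{\varpi\in\overline{\Omega}_K}\left\{g\in\mathbb{R}^M:\ \omega\neq\varpi\ \text{ and }\ g^T(\Pi_\omega-\Pi_\varpi)g=n\beta\right\}$$ and suppose $d\in\mathbb{R}^M\setminus\Sigma_K$. Then: (i) the set $\mathbb{R}^M\setminus\Sigma_K$ is open and dense in $\mathbb{R}^M$; (ii) $F_d(u)=\|Au-d\|_2^2+\beta\|u\|_0$ has a unique global minimizer $\hat u$ over $\mathbb{R}^N$, and $\|\hat u\|_0\le K$.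
   Context: For $u\in\mathbb{R}^N$, $\sigma(u)=\{i: u[i]\ne0\}$ and $\|u\|_0=\#\sigma(u)$. For $\omega\subseteq\{1,\dots,N\}$, $A_\omega\in\mathbb{R}^{M\times\#\omega}$ is the submatrix of $A$ formed by the columns indexed by $\omega$. For $r\in\{1,\dots,M\}$, $\Omega_r=\{\omega\subset\{1,\dots,N\}:\#\omega=r=\operatorname{rank}(A_\omega)\}$; $\Omega_0=\{\varnothing\}$; $\overline{\Omega}_K=\bigcup_{r=0}^{K}\Omega_r$. For $\omega\in\bigcup_{r=0}^{M-1}\Omega_r$, $\Pi_\omega=A_\omega(A_\omega^TA_\omega)^{-1}A_\omega^T$ is the orthogonal projector of $\mathbb{R}^M$ onto the range of $A_\omega$, with $\Pi_\varnothing=0$. H1 for $K$: for every $r\in\{1,\dots,K\}$ and all $\omega,\varpi\in\Omega_r$ with $\omega\ne\varpi$, one has $\Pi_\omega\ne\Pi_\varpi$. (A number $\beta_K$ as in the claim always exists; for instance $\beta_K=\|A\tilde u-d\|_2^2$, where $\tilde u$ minimizes $\|Au-d\|_2^2$ over $u$ with $u[i]=0$ for $i\notin\omega$, for some $\omega\in\Omega_K$.) *)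

(* Defs.v *)
From mathcomp Require Import all_boot all_order all_algebra.
From mathcomp Require Import all_classical all_reals all_analysis.
Import Order.TTheory GRing.Theory Num.Theory.
Import numFieldNormedType.Exports.

Set Implicit Arguments.
Unset Strict Implicit.
Unset Printing Implicit Defensive.

Local Open Scope classical_set_scope.
Local Open Scope ring_scope.

Definition supp (R : realType) (N : nat) (u : 'cV[R]_N) : {set 'I_N} :=
  [set i | u i 0 != 0]%SET.

Definition l0norm (R : realType) (N : nat) (u : 'cV[R]_N) : nat := #|supp u|.

(* The squared Euclidean norm; the library norm on matrices is the sup norm. *)
Definition sqnorm2 (R : realType) (M : nat) (v : 'cV[R]_M) : R :=
  \sum_(i < M) v i 0 ^+ 2.

(* [enum_val] lists the elements of [w] in increasing order. *)
Definition subcols (R : realType) (M N : nat) (A : 'M[R]_(M, N))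
    (w : {set 'I_N}) : 'M[R]_(M, #|w|) :=
  colsub (fun k : 'I_#|w| => enum_val k) A.

(* For r = 0 this is the singleton of the empty set. *)
Definition Omega (R : realType) (M N : nat) (A : 'M[R]_(M, N)) (r : nat) :
    {set {set 'I_N}} :=
  [set w : {set 'I_N} | (#|w| == r) && (\rank (subcols A w) == r)]%SET.

Definition Omegabar (R : realType) (M N : nat) (A : 'M[R]_(M, N)) (K : nat) :
    {set {set 'I_N}} :=
  (\bigcup_(r < K.+1) Omega A r)%SET.

(* For the empty set the inner dimension is 0, so the product is 0. *)
Definition Proj (R : realType) (M N : nat) (A : 'M[R]_(M, N))
    (w : {set 'I_N}) : 'M[R]_M :=
  let Aw := subcols A w in Aw *m invmx (Aw^T *m Aw) *m Aw^T.

Definition H1 (R : realType) (M N : nat) (A : 'M[R]_(M, N)) (K : nat) : Prop :=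
  forall r : nat, (1 <= r <= K)%N ->
  forall w v : {set 'I_N}, w \in Omega A r -> v \in Omega A r ->
  w <> v -> Proj A w <> Proj A v.

Definition objective (R : realType) (M N : nat) (A : 'M[R]_(M, N))
    (d : 'cV[R]_M) (beta : R) (u : 'cV[R]_N) : R :=
  sqnorm2 (A *m u - d) + beta * (l0norm u)%:R.

Definition global_minimizer (R : realType) (N : nat) (f : 'cV[R]_N -> R)
    (u : 'cV[R]_N) : Prop :=
  forall v : 'cV[R]_N, f u <= f v.

Definition Sigma (R : realType) (M N : nat) (A : 'M[R]_(M, N)) (K : nat)
    (beta : R) : set 'cV[R]_M :=
  \bigcup_(n in [set n : int | - K%:Z <= n <= K%:Z])
  \bigcup_(w in [set w | w \in Omegabar A K])
  \bigcup_(v in [set v | v \in Omegabar A K])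
    [set g : 'cV[R]_M | w <> v /\
       (g^T *m (Proj A w - Proj A v) *m g) 0 0 = n%:~R * beta].

(* Main.v *)
(* A minimizer u with support w of full column rank solves the least-squares
   problem restricted to w, so its value is |d|^2 - d^T Pi_w d + beta #w. Two
   minimizers with distinct supports w and v would therefore satisfy
   d^T (Pi_w - Pi_v) d = beta (#w - #v), which puts d in Sigma; with equal
   supports the normal equations force them to coincide. Under H1 the map
   w |-> Pi_w is injective on Omegabar (the rank of Pi_w recovers #w), so Sigma
   is a finite union of level sets of nonzero quadratic forms, each of which is
   closed with empty interior. *)

Require Import Defs.
From mathcomp Require Import all_boot all_order all_algebra.
From mathcomp Require Import ring lra zify.
From mathcomp Require Import all_classical all_reals all_analysis.
Import Order.TTheory GRing.Theory Num.Theory.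
Import numFieldNormedType.Exports.

Set Implicit Arguments.
Unset Strict Implicit.
Unset Printing Implicit Defensive.

Local Open Scope classical_set_scope.
Local Open Scope ring_scope.

(** * Finite unions of closed sets with dense complement *)

Lemma open_dense_setC_bigcup (T : topologicalType) (I : choiceType) (D : set I)
    (F : I -> set T) : finite_set D ->
    (forall i, D i -> open (~` F i) /\ dense (~` F i)) ->
  open (~` \bigcup_(i in D) F i) /\ dense (~` \bigcup_(i in D) F i).
Proof.
move=> /finite_seqP[s ->]; elim: s => [|i s IHs] FP.
  rewrite set_nil bigcup_set0 setC0; split; first exact: openT.
  by move=> O [x Ox] _; exists x.
rewrite [X in bigcup X](_ : _ = i |` [set` s]); last first.
  by apply/funext => j; apply/propext; rewrite /= in_cons; split=> /predU1P.
rewrite bigcup_setU1 setCU.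
have [oi di] : open (~` F i) /\ dense (~` F i) by apply: FP; rewrite /= mem_head.
have [os ds] : open (~` \bigcup_(j in [set` s]) F j) /\
    dense (~` \bigcup_(j in [set` s]) F j).
  by apply: IHs => j /= js; apply: FP; rewrite /= in_cons js orbT.
(* Two dense sets have a dense intersection as soon as one of them is open, so openness has to be
   carried through the induction. *)
by split; [exact: openI | exact: denseI].
Qed.

(** * Level sets of quadratic forms *)

Definition bform (R : realType) (M : nat) (Q : 'M[R]_M) (x y : 'cV[R]_M) : R :=
  (x^T *m Q *m y) 0 0.

Lemma bform_sum (R : realType) (M : nat) (Q : 'M[R]_M) (x y : 'cV[R]_M) :
  bform Q x y = \sum_j (\sum_i x i 0 * Q i j) * y j 0.
Proof.
rewrite /bform mxE; apply: eq_bigr => j _; rewrite mxE; congr (_ * _).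
by apply: eq_bigr => i _; rewrite mxE.
Qed.

Lemma bform_continuous (R : realType) (M : nat) (Q : 'M[R]_M) :
  continuous (fun g : 'cV[R]_M => bform Q g g).
Proof.
rewrite (_ : (fun g => _) =
  (fun g : 'cV[R]_M => \sum_j (\sum_i g i 0 * Q i j) * g j 0)); last first.
  by apply/funext => g; exact: bform_sum.
have lin j : continuous (fun g : 'cV[R]_M => \sum_i g i 0 * Q i j).
  apply: continuous_big => [|i _ g]; first exact: add_continuous.
  apply: (@continuousM R _ (fun h : 'cV[R]_M => h i 0) (fun=> Q i j)).
    exact: coord_continuous.
  exact: cst_continuous.
apply: continuous_big => [|j _ g]; first exact: add_continuous.
apply: (@continuousM R _ (fun h : 'cV[R]_M => _) (fun h => h j 0)).
  exact: lin.
exact: coord_continuous.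
Qed.

Lemma bformDZ (R : realType) (M : nat) (Q : 'M[R]_M) (t : R) (x y : 'cV[R]_M) :
  bform Q (x + t *: y) (x + t *: y) =
  bform Q x x + t * (bform Q x y + bform Q y x) +
  t ^+ 2 * bform Q y y.
Proof.
rewrite /bform [(x + _)^T]linearD /= [(t *: y)^T]linearZ /=.
rewrite !mulmxDl !mulmxDr -!scalemxAl -!scalemxAr.
rewrite !mxE; ring.
Qed.

Lemma bform_delta (R : realType) (M : nat) (Q : 'M[R]_M) (i j : 'I_M) :
  bform Q (delta_mx i 0) (delta_mx j 0) = Q i j.
Proof. by rewrite /bform trmx_delta -rowE -colE !mxE. Qed.

(** Polarization: the value at the sum of the basis vectors [i] and [j] reduces to [Q i j + Q j i],
    which is [2 * Q i j] by symmetry. *)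
Lemma sym_bform_eq0 (R : realType) (M : nat) (Q : 'M[R]_M) :
  Q^T = Q -> (forall x, bform Q x x = 0) -> Q = 0.
Proof.
move=> Qsym Q0; apply/matrixP => i j; rewrite [RHS]mxE.
have := bformDZ Q 1 (delta_mx i 0) (delta_mx j 0).
have Qji : Q j i = Q i j by rewrite -[in LHS]Qsym mxE.
rewrite !Q0 !bform_delta Qji; lra.
Qed.

Lemma open_segment (R : realType) (M : nat) (O : set 'cV[R]_M)
    (g h : 'cV[R]_M) : open O -> O g ->
  exists2 t : R, 0 < t & O (g + t *: h) /\ O (g + (- t) *: h).
Proof.
move=> oO Og; have /nbhs_ballP[e /= e0 eO] := open_nbhs_nbhs (conj oO Og).
(* The summand 1 keeps [H] positive when [h = 0] and strictly above every entry of [h], so a step of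
   size [e / H] moves each coordinate by less than [e]. *)
pose H := 1 + \sum_i `|h i 0|.
have H0 : 0 < H by rewrite ltr_pwDl// sumr_ge0.
have hH i : `|h i 0| < H.
  rewrite /H (bigD1 i)//= addrCA ltrDl ltr_pwDl// sumr_ge0//.
have key (s : R) : `|s| = e / H -> O (g + s *: h).
  move=> se; apply: eO; rewrite /ball /= /mx_ball; split=> // i j.
  rewrite /ball /= !mxE opprD addrA subrr sub0r normrN normrM se ord1.
  by rewrite mulrAC ltr_pdivrMr// ltr_pM2l.
exists (e / H); first exact: divr_gt0.
by split; apply: key; rewrite ?normrN gtr0_norm// divr_gt0.
Qed.

(* Averaging the form at [g + t h] and [g - t h] isolates its value at [h]. *)
Lemma open_dense_quadric_setC (R : realType) (M : nat) (Q : 'M[R]_M) (c : R) :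
  Q^T = Q -> Q <> 0 ->
  open (~` [set g : 'cV[R]_M | bform Q g g = c]) /\
  dense (~` [set g : 'cV[R]_M | bform Q g g = c]).
Proof.
move=> Qsym Q0; split.
  apply: closed_openC.
  apply: (@preimage_closed _ _ (fun g => bform Q g g) [set x | x = c]).
    by move=> x _; exact: bform_continuous.
  exact: closed_eq.
move=> O [g Og] oO; apply: contra_notP Q0 => Oc.
have {}Oc x : O x -> bform Q x x = c.
  by move=> Ox; apply: contra_notP Oc => xc; exists x.
apply: sym_bform_eq0 => // h; have [t t0 [Op Om]] := open_segment h oO Og.
have := Oc _ Op; have := Oc _ Om; have := Oc _ Og; rewrite !bformDZ => -> Em Ep.
have : t ^+ 2 * bform Q h h = 0.
  move: Em Ep; set a := _ + bform Q h g; rewrite sqrrN; lra.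
by move/eqP; rewrite mulf_eq0 sqrf_eq0 gt_eqF//= => /eqP.
Qed.

(** * Gram matrices and the normal equations *)

Lemma sqnorm2E (R : realType) (M : nat) (v : 'cV[R]_M) :
  sqnorm2 v = (v^T *m v) 0 0.
Proof. by rewrite mxE; apply: eq_bigr => i _; rewrite mxE expr2. Qed.

Lemma sqnorm2_ge0 (R : realType) (M : nat) (v : 'cV[R]_M) : 0 <= sqnorm2 v.
Proof. by apply: sumr_ge0 => i _; exact: sqr_ge0. Qed.

Lemma sqnorm2_eq0 (R : realType) (M : nat) (v : 'cV[R]_M) :
  sqnorm2 v = 0 -> v = 0.
Proof.
move=> /eqP; rewrite psumr_eq0 => [|i _]; last exact: sqr_ge0.
move=> /allP v0; apply/matrixP => i j; rewrite ord1 mxE.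
by apply/eqP; rewrite -sqrf_eq0; apply: v0; rewrite mem_index_enum.
Qed.

(** Pairing the hypothesis with [x] gives the squared norm of [B *m x]. *)
Lemma gram_mul_eq0 (R : realType) (M n : nat) (B : 'M[R]_(M, n)) (x : 'cV[R]_n) :
  B^T *m B *m x = 0 -> B *m x = 0.
Proof.
move=> BBx; apply: sqnorm2_eq0.
by rewrite sqnorm2E trmx_mul -mulmxA (mulmxA B^T) BBx mulmx0 mxE.
Qed.

(** The columns of the cokernel of the Gram matrix are killed by it, hence by [B], and this is the
    inclusion of row spaces. It yields both the invertibility of the Gram matrix at full column rank
    and the solvability of the normal equations. *)
Lemma submx_gram (R : realType) (M n : nat) (B : 'M[R]_(M, n)) :
  (B <= B^T *m B)%MS.
Proof.
rewrite submxE; apply/eqP/matrixP => i j.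
have : B^T *m B *m col j (cokermx (B^T *m B)) = 0.
  by rewrite !colE mulmxA mulmx_coker mul0mx.
by move=> /gram_mul_eq0/matrixP/(_ i 0); rewrite !colE mulmxA -colE !mxE.
Qed.

Lemma gram_unit (R : realType) (M n : nat) (B : 'M[R]_(M, n)) :
  \rank B = n -> B^T *m B \in unitmx.
Proof.
move=> rB; rewrite -row_full_unit -col_leq_rank.
by rewrite -[X in (X <= _)%N]rB mxrankS// submx_gram.
Qed.

Definition normal_eq (R : realType) (M n : nat) (B : 'M[R]_(M, n))
    (d : 'cV[R]_M) (y : 'cV[R]_n) : Prop := B^T *m (B *m y - d) = 0.

Lemma normal_eq_exists (R : realType) (M n : nat) (B : 'M[R]_(M, n))
    (d : 'cV[R]_M) : exists y, normal_eq B d y.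
Proof.
have /submxP[y yP] : (d^T *m B <= B^T *m B)%MS.
  exact: submx_trans (submxMl _ _) (submx_gram _).
exists y^T; rewrite /normal_eq mulmxBr mulmxA; apply/eqP; rewrite subr_eq0.
by rewrite -[_ *m d]trmxK trmx_mul trmxK yP !trmx_mul trmxK.
Qed.

(** The residual at [y] is orthogonal to the range of [B], so the cross terms vanish. *)
Lemma normal_eq_pythagoras (R : realType) (M n : nat) (B : 'M[R]_(M, n))
    (d : 'cV[R]_M) (y x : 'cV[R]_n) : normal_eq B d y ->
  sqnorm2 (B *m x - d) = sqnorm2 (B *m y - d) + sqnorm2 (B *m (x - y)).
Proof.
move=> ny; have -> : B *m x - d = B *m (x - y) + (B *m y - d).
  by rewrite mulmxBr addrA subrK.
have : (B *m (x - y))^T *m (B *m y - d) = 0.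
  by rewrite trmx_mul -mulmxA ny mulmx0.
move: (B *m (x - y)) (B *m y - d) => p q pq.
have qp : q^T *m p = 0 by rewrite -[p]trmxK -trmx_mul pq trmx0.
rewrite !sqnorm2E [(p + q)^T]linearD /= mulmxDl !mulmxDr pq qp addr0 add0r addrC.
by rewrite [LHS]mxE.
Qed.

(** * Orthogonal projectors onto column spans *)

Lemma tr_Proj (R : realType) (M N : nat) (A : 'M[R]_(M, N)) (w : {set 'I_N}) :
  (Proj A w)^T = Proj A w.
Proof. by rewrite /Proj !trmx_mul trmx_inv trmx_mul !trmxK mulmxA. Qed.

Lemma Proj_subcols (R : realType) (M N : nat) (A : 'M[R]_(M, N)) (w : {set 'I_N})
    (wfree : \rank (subcols A w) = #|w|) :
  Proj A w *m subcols A w = subcols A w.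
Proof.
by rewrite /Proj -!mulmxA mulVmx ?mulmx1//; exact: gram_unit.
Qed.

(** The projector factors through [subcols A w], which bounds its rank above, and fixes
    [subcols A w], which bounds it below. *)
Lemma rank_Proj (R : realType) (M N : nat) (A : 'M[R]_(M, N)) (w : {set 'I_N})
    (wfree : \rank (subcols A w) = #|w|) :
  \rank (Proj A w) = #|w|.
Proof.
apply/eqP; rewrite eqn_leq; apply/andP; split.
  by rewrite /Proj -mulmxA (leq_trans (mxrankM_maxl _ _))// wfree.
by rewrite -{1}wfree -{1}(Proj_subcols wfree) mxrankM_maxl.
Qed.

Lemma normal_eq_Proj (R : realType) (M N : nat) (A : 'M[R]_(M, N)) (w : {set 'I_N})
    (wfree : \rank (subcols A w) = #|w|)
    (d : 'cV[R]_M) (y : 'cV[R]_#|w|) :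
  normal_eq (subcols A w) d y ->
  y = invmx ((subcols A w)^T *m subcols A w) *m (subcols A w)^T *m d.
Proof.
rewrite /normal_eq mulmxBr => /eqP; rewrite subr_eq0 => /eqP E.
by rewrite -mulmxA -E [_^T *m (_ *m y)]mulmxA mulKmx//; exact: gram_unit.
Qed.

(** The residual is orthogonal to the fitted vector, so only its pairing with [-d] survives, and the
    fitted vector is the projection of [d]. *)
Lemma sqnorm2_normal_eq (R : realType) (M N : nat) (A : 'M[R]_(M, N))
    (w : {set 'I_N})
    (wfree : \rank (subcols A w) = #|w|)
    (d : 'cV[R]_M) (y : 'cV[R]_#|w|) :
  normal_eq (subcols A w) d y ->
  sqnorm2 (subcols A w *m y - d) = sqnorm2 d - (d^T *m Proj A w *m d) 0 0.
Proof.
move=> ny; rewrite sqnorm2E [(_ - d)^T]linearB /= mulmxBl trmx_mul.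
rewrite -[y^T *m _ *m _]mulmxA ny mulmx0 sub0r.
rewrite mulmxBr opprB (normal_eq_Proj wfree ny) /Proj !mulmxA mxE sqnorm2E.
by congr (_ + _); rewrite mxE.
Qed.

(** * Zero-padding of vectors indexed by a support *)

Definition embed (R : realType) (N : nat) (w : {set 'I_N}) : 'M[R]_(N, #|w|) :=
  subcols 1%:M w.

Lemma subcols_embed (R : realType) (M N : nat) (A : 'M[R]_(M, N))
  (w : {set 'I_N}) : subcols A w = A *m embed R w.
Proof. by rewrite /embed /subcols mulmx_colsub mulmx1. Qed.

Lemma supp_embed (R : realType) (N : nat) (w : {set 'I_N}) (x : 'cV[R]_#|w|) :
  supp (embed R w *m x) \subset w.
Proof.
apply/fintype.subsetP => i; rewrite inE; apply: contra_neqT => iw.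
rewrite mxE big1// => k _; rewrite !mxE.
case: eqP => [ik|_]; last by rewrite mul0r.
by rewrite ik enum_valP in iw.
Qed.

Lemma embedK (R : realType) (N : nat) (w : {set 'I_N}) (u : 'cV[R]_N) :
  supp u \subset w -> exists x, u = embed R w *m x.
Proof.
move=> uw; exists (\col_k u (enum_val k) 0); apply/matrixP => i j.
rewrite ord1 mxE; have [iw|iw] := boolP (i \in w).
  (* In row [i] of [embed R w], only the position of [i] in the enumeration of [w] carries a nonzero
     entry. *)
  rewrite (bigD1 (enum_rank_in iw i))//= big1 => [|k ki]; last first.
    rewrite !mxE; case: eqP => [E|_]; last by rewrite mul0r.
    by have := enum_valK_in iw k; rewrite -E => kE; rewrite kE eqxx in ki.
  by rewrite !mxE enum_rankK_in// eqxx mul1r addr0.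
rewrite big1 => [|k _].
  by apply: contraNeq iw => ui; apply: (fintype.subsetP uw); rewrite inE.
rewrite !mxE; case: eqP => [ik|_]; last by rewrite mul0r.
by rewrite ik enum_valP in iw.
Qed.

(** * Injectivity of the projector map and the topology of the complement of [Sigma] *)

Lemma in_Omegabar (R : realType) (M N K : nat) (A : 'M[R]_(M, N))
    (w : {set 'I_N}) :
  (w \in Omegabar A K) = (#|w| <= K)%N && (\rank (subcols A w) == #|w|).
Proof.
apply/bigcupP/andP => [[r _]|[wK wfree]].
  by rewrite inE => /andP[/eqP wr /eqP ->]; rewrite wr eqxx -ltnS.
by exists (Ordinal (wK : (#|w| < K.+1)%N)); rewrite // inE eqxx.
Qed.

Lemma Proj_inj (R : realType) (M N K : nat) (A : 'M[R]_(M, N))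
    (w v : {set 'I_N}) : H1 A K ->
  w \in Omegabar A K -> v \in Omegabar A K -> Proj A w = Proj A v -> w = v.
Proof.
move=> hH1; rewrite !in_Omegabar => /andP[wK /eqP wfree] /andP[_ /eqP vfree] wv.
have cwv : #|w| = #|v| by rewrite -(rank_Proj wfree) wv rank_Proj.
(* H1 starts at cardinality 1; at cardinality 0 both sets are empty. *)
have [w0|w0] := posnP #|w|.
  by rewrite (cards0_eq w0) (cards0_eq (etrans (esym cwv) w0)).
apply: contrapT => neq_wv; apply: (hH1 #|w| _ w v) wv => //.
- by rewrite w0.
- by rewrite inE wfree eqxx.
- by rewrite inE vfree cwv eqxx.
Qed.

Lemma finite_int_itv (K : nat) :
  finite_set [set n : int | - K%:Z <= n <= K%:Z].
Proof.
(* Shifting by [K] moves the interval to the naturals from 0 to [2K]; the successor is there because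
   the initial segment excludes its bound. *)
apply: (@sub_finite_set _ _ ((fun m : nat => m%:Z - K%:Z) @` `I_(K + K).+1)).
  move=> n /= /andP[Kn nK]; exists (absz (n + K%:Z)); lia.
exact: finite_image.
Qed.

Lemma open_dense_Sigma_setC (R : realType) (M N K : nat) (A : 'M[R]_(M, N))
    (beta : R) : H1 A K ->
  open (~` Sigma A K beta) /\ dense (~` Sigma A K beta).
Proof.
move=> hH1; apply: open_dense_setC_bigcup => [|n _]; first exact: finite_int_itv.
apply: open_dense_setC_bigcup => [|w /= wK]; first exact: finite_finset.
apply: open_dense_setC_bigcup => [|v /= vK]; first exact: finite_finset.
(* On the diagonal the form is zero, but the clause [w <> v] makes the set empty; off it,
   injectivity makes the form nonzero. *)
have [wv|/eqP wv] := eqVneq w v.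
  rewrite (_ : [set g | _] = set0) ?setC0.
    by split; [exact: openT|move=> O [x Ox] _; exists x].
  by apply/seteqP; split=> // g [].
rewrite (_ : [set g | _] =
  [set g | bform (Proj A w - Proj A v) g g = n%:~R * beta]); last first.
  by apply/seteqP; split=> g // [].
apply: open_dense_quadric_setC; first by rewrite linearB /= !tr_Proj.
by move=> /subr0_eq/(Proj_inj hH1 wK vK).
Qed.

(** * Least squares on a prescribed support and global minimizers *)

Lemma constrained_least_squares (R : realType) (M N : nat) (A : 'M[R]_(M, N))
    (d : 'cV[R]_M) (w : {set 'I_N}) :
  exists u, supp u \subset w /\ forall v, supp v \subset w ->
    sqnorm2 (A *m u - d) <= sqnorm2 (A *m v - d).
Proof.
have [y ny] := normal_eq_exists (subcols A w) d.
exists (embed R w *m y); split=> [|v /embedK[x ->]]; first exact: supp_embed.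
rewrite !mulmxA -!subcols_embed (normal_eq_pythagoras x ny) lerDl.
exact: sqnorm2_ge0.
Qed.

(** There are finitely many supports, so a best one exists among the constrained solutions [f w].
    Any [v] is beaten by [f (supp v)], which fits at least as well and whose support lies in that of
    [v]. *)
Lemma global_minimizer_exists (R : realType) (M N : nat) (A : 'M[R]_(M, N))
    (d : 'cV[R]_M) (beta : R) : 0 <= beta ->
  exists u, global_minimizer (objective A d beta) u.
Proof.
move=> beta0; have [f fP] := choice (constrained_least_squares A d).
have [w _ wmin] := arg_minP (fun w => objective A d beta (f w))
  (erefl : predT (@finset.set0 'I_N)).
exists (f w) => v; apply: le_trans (wmin (supp v) isT) _.
have [fv vmin] := fP (supp v); apply: lerD; first exact: vmin.
by rewrite ler_wpM2l// ler_nat subset_leq_card.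
Qed.

(** The competitor is a least-squares solution on the support of [u]. Its penalty is no larger, so
    minimality of [u] forces the Pythagorean excess to vanish, and both have the same image under
    the selected columns. *)
Lemma global_minimizer_normal_eq (R : realType) (M N : nat) (A : 'M[R]_(M, N))
    (d : 'cV[R]_M) (beta : R) (u : 'cV[R]_N) : 0 <= beta ->
    global_minimizer (objective A d beta) u ->
  exists2 y, u = embed R (supp u) *m y & normal_eq (subcols A (supp u)) d y.
Proof.
move=> beta0 umin; have [y uy] := embedK (subxx (supp u)); exists y => //.
have [x nx] := normal_eq_exists (subcols A (supp u)) d.
have le_l0 : beta * (l0norm (embed R (supp u) *m x))%:R <= beta * (l0norm u)%:R.
  by rewrite ler_wpM2l// ler_nat subset_leq_card// supp_embed.
have := umin (embed R (supp u) *m x); rewrite /objective {1}uy.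
rewrite !mulmxA -!subcols_embed (normal_eq_pythagoras y nx) => le_obj.
have : subcols A (supp u) *m (y - x) = 0.
  apply: sqnorm2_eq0; apply/eqP; rewrite eq_le sqnorm2_ge0 andbT; lra.
by rewrite mulmxBr => /subr0_eq yx; rewrite /normal_eq yx.
Qed.

Theorem theorem5p6 (R : realType) (M N K : nat) (A : 'M[R]_(M, N))
    (d : 'cV[R]_M) (betaK beta : R)
    (hcol : forall j : 'I_N, col j A != 0)
    (hrank : \rank A = M) (hMN : (M < N)%N)
    (hK : (1 <= K <= M - 1)%N)
    (hH1 : H1 A K)
    (hbetaK0 : 0 <= betaK)
    (hbetaK : forall beta' : R, betaK < beta' ->
       forall u : 'cV[R]_N, global_minimizer (objective A d beta') u ->
       (l0norm u <= K)%N /\ supp u \in Omegabar A K)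
    (hbeta : betaK < beta) (hbeta0 : 0 < beta)
    (hd : (~` Sigma A K beta) d) :
  (open (~` Sigma A K beta) /\ dense (~` Sigma A K beta)) /\
  (exists u : 'cV[R]_N,
     [/\ global_minimizer (objective A d beta) u,
         (forall v : 'cV[R]_N,
            global_minimizer (objective A d beta) v -> v = u)
       & (l0norm u <= K)%N]).
Proof.
split; first exact: open_dense_Sigma_setC.
have beta_ge0 := ltW hbeta0.
have [u umin] := global_minimizer_exists A d beta_ge0.
have [uK uO] := hbetaK _ hbeta _ umin.
exists u; split=> // v vmin; have [vK vO] := hbetaK _ hbeta _ vmin.
have /andP[_ /eqP ufree] := etrans (esym (in_Omegabar K A _)) uO.
have /andP[_ /eqP vfree] := etrans (esym (in_Omegabar K A _)) vO.
have [y uy ny] := global_minimizer_normal_eq beta_ge0 umin.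
have [x vx nx] := global_minimizer_normal_eq beta_ge0 vmin.
have [uv|/eqP uv] := eqVneq (supp u) (supp v).
  (* The type of [x] depends on [supp v]; once the supports are identified, [x] and [y] solve the
     same invertible system. *)
  rewrite -uv in x vx nx.
  by rewrite uy vx (normal_eq_Proj ufree ny) (normal_eq_Proj ufree nx).
have uval : objective A d beta u =
    sqnorm2 d - (d^T *m Proj A (supp u) *m d) 0 0 + beta * (l0norm u)%:R.
  by rewrite /objective {1}uy mulmxA -subcols_embed (sqnorm2_normal_eq ufree ny).
have vval : objective A d beta v =
    sqnorm2 d - (d^T *m Proj A (supp v) *m d) 0 0 + beta * (l0norm v)%:R.
  by rewrite /objective {1}vx mulmxA -subcols_embed (sqnorm2_normal_eq vfree nx).
(* Both cardinalities lie between 0 and [K], so their difference is an admissible level index. *)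
case: hd; exists ((l0norm u)%:Z - (l0norm v)%:Z); first by rewrite /=; lia.
exists (supp u) => //; exists (supp v) => //; split=> //.
have -> : (d^T *m (Proj A (supp u) - Proj A (supp v)) *m d) 0 0 =
    (d^T *m Proj A (supp u) *m d) 0 0 - (d^T *m Proj A (supp v) *m d) 0 0.
  by rewrite mulmxBr mulmxBl mxE [X in _ + X]mxE.
(* The two minimality inequalities make the objective values equal, and cancelling the squared norm
   of [d] leaves the required equation. *)
have := umin v; have := vmin u; rewrite uval vval intrB; lra.
Qed.
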